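(* Let $m\geq 5$ and let $H=K_{m,m}\setminus E(C_{2m})$ be the (connected) graph obtained from the complete bipartite graph $K_{m,m}$ by deleting all the edges of a Hamiltonian cycle $C_{2m}$ of $K_{m,m}$ (keeping all vertices). Then $\beta(H)=\left\lfloor \frac{4m}{5}\right\rfloor$.
   Context: All graphs are finite, simple and connected. $d(u,v)$ denotes the length of a shortest $u$–$v$ path in the graph. For an ordered set $W=\{w_1,\dots,w_k\}$ of vertices and a vertex $v$, put $r(v\mid W)=(d(v,w_1),\dots,d(v,w_k))$. $W$ is a resolving set if $r(x\mid W)\neq r(y\mid W)$ for every two distinct vertices $x,y$. The metric dimension $\beta(H)$ is the minimum cardinality of a resolving set of $H$. *)

(* Defs.v *)
From mathcomp Require Import all_boot.

Set Implicit Arguments.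
Unset Strict Implicit.
Unset Printing Implicit Defensive.

(* A finite simple graph on T : finType is a symmetric
   irreflexive e : rel T. *)

Section Graph.
Variables (T : finType) (e : rel T).

Definition connected : bool := [forall x, forall y, connect e x y].

Definition has_path_of_length (x y : T) (n : nat) : bool :=
  [exists p : n.-tuple T, [&& path e x p, uniq (x :: p) & last x p == y]].

(* Paths have fewer than #|T| edges, so the search range is exhaustive; the
   value is #|T| exactly when y is not reachable from x. *)
Definition dist (x y : T) : nat :=
  find (has_path_of_length x y) (iota 0 #|T|).

Definition metric_repr (v : T) (W : seq T) : seq nat :=
  [seq dist v w | w <- W].

(* W is meant to be duplicate-free: an ordered set of vertices. *)
Definition resolving (W : seq T) : bool :=
  [forall x, forall y, (x != y) ==> (metric_repr x W != metric_repr y W)].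

Lemma dist_eq0 (x y : T) : (dist x y == 0) = (x == y).
Proof.
have T0 : 0 < #|T| by apply/card_gt0P; exists x.
have E : has_path_of_length x y 0 = (x == y).
  apply/existsP/idP => [[p]|xy]; first by rewrite (tuple0 p) => /and3P[].
  by exists [tuple].
rewrite /dist -(prednK T0) /= E.
by case: (x == y).
Qed.

Lemma resolving_setT : resolving (enum [set: T]).
Proof.
apply/forallP => x; apply/forallP => y; apply/implyP; apply: contra => /eqP E.
have /eq_in_map/(_ x) : metric_repr x (enum [set: T]) =
  metric_repr y (enum [set: T]) by [].
rewrite mem_enum inE => /(_ isT) /eqP.
by rewrite (eqP (_ : dist x x == 0)) ?dist_eq0 // eq_sym dist_eq0 eq_sym.
Qed.

(* Whether a set resolves does not depend on the order in which it is listed,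
   so each set is represented by its canonical enumeration. By resolving_setT,
   the default of the arg min is admissible. *)
Definition metric_dim : nat :=
  #|[arg min_(W < [set: T] | resolving (enum W)) #|W| ]|.

Definition hamiltonian_cycle (c : seq T) : bool :=
  [&& 2 < size c, cycle e c, uniq c & [forall x, x \in c]].

End Graph.

Section DeleteCycle.
Variables (T : finType) (e : rel T) (c : seq T).

(* Membership is needed because next c x = x when x is not in c. *)
Definition cycle_edge : rel T := fun x y =>
  [&& x \in c, y \in c & (next c x == y) || (next c y == x)].

Definition del_cycle : rel T := fun x y => e x y && ~~ cycle_edge x y.

Lemma del_cycle_sym : symmetric e -> symmetric del_cycle.
Proof.
by move=> se x y; rewrite /del_cycle /cycle_edge se andbCA orbC.
Qed.

Lemma del_cycle_irr : irreflexive e -> irreflexive del_cycle.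
Proof. by move=> ie x; rewrite /del_cycle ie. Qed.

End DeleteCycle.

Section CompleteBipartite.
Variables m n : nat.

Definition complete_bipartite : rel ('I_m + 'I_n) := fun x y =>
  match x, y with
  | inl _, inr _ | inr _, inl _ => true
  | _, _ => false
  end.

Lemma complete_bipartite_sym : symmetric complete_bipartite.
Proof. by case=> x [] y. Qed.

Lemma complete_bipartite_irr : irreflexive complete_bipartite.
Proof. by case. Qed.

End CompleteBipartite.

(* Main.v *)
(** Write [0] and [1] around the cycle for vertices outside and inside [W].
  In the graph two vertices on the same side are at distance 0 or 2, and two
  vertices on opposite sides are at distance 1, or 3 when they are consecutive
  on the cycle. Hence a nonempty [W] resolves iff no factor [00100] occurs and
  the factors [000] have their centres on different sides, so that there are at
  most two of them.
  Lower bound, by discharging: a [1] gives 2 to each neighbouring [0] whose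
  other neighbour is [0], and 1 to each neighbouring [0] whose other neighbour
  is [1]. Every [0] but the at most two centres of [000] gets 2, and a [1] gives
  at most 3 since [00100] does not occur: [2 (2m - k - 2) <= 3 k].
  Upper bound: repeat [10100] around the cycle, erasing the first [1] of the
  incomplete last block. *)
Require Import Defs.
From mathcomp Require Import all_boot.
From mathcomp Require Import zify.

Set Implicit Arguments.
Unset Strict Implicit.
Unset Printing Implicit Defensive.

(** * Computing distances and the metric dimension from bounds *)

Section Dist.
Variables (T : finType) (e : rel T).

Lemma has_path_connect (x y : T) (n : nat) :
  has_path_of_length e x y n -> connect e x y.
Proof.
by case/existsP=> p /and3P[ep _ /eqP <-]; apply/connectP; exists (val p).
Qed.

Lemma dist_eq (x y : T) (n : nat) :
  n < #|T| -> has_path_of_length e x y n ->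
  (forall k, k < n -> ~~ has_path_of_length e x y k) -> dist e x y = n.
Proof.
move=> nT pn Npk; rewrite /dist.
have -> : iota 0 #|T| = iota 0 n ++ n :: iota n.+1 (#|T| - n.+1).
  by rewrite -[n :: _]/(iota n (#|T| - n.+1).+1) -iotaD; congr iota; lia.
rewrite find_cat has_find size_iota ifF /= ?pn ?addn0 //.
apply/negbTE; rewrite -{2}(size_iota 0 n) -has_find.
by apply/hasPn => k; rewrite mem_iota => /andP[_ /Npk].
Qed.

Lemma metric_repr_eq (W : {set T}) (x y : T) :
  metric_repr e x (enum W) = metric_repr e y (enum W) <->
  {in W, dist e x =1 dist e y}.
Proof.
split=> [/eq_in_map xy w wW | xy]; first by apply: xy; rewrite mem_enum.
by apply/eq_in_map => w; rewrite mem_enum => /xy.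
Qed.

Lemma metric_dim_eq (n : nat) :
  (forall W : {set T}, resolving e (enum W) -> n <= #|W|) ->
  (exists2 W : {set T}, resolving e (enum W) & #|W| <= n) ->
  metric_dim e = n.
Proof.
move=> lb [W rW Wn]; rewrite /metric_dim.
case: arg_minnP => [|V rV minV]; first exact: resolving_setT.
by apply/eqP; rewrite eqn_leq lb // (leq_trans (minV W rW)).
Qed.

End Dist.

(** * Bipartite graphs minus a cycle with successor [f] and predecessor [g] *)

Section BipartiteMinusCycle.
Variables (T : finType) (e : rel T) (side : T -> bool) (f g : T -> T).
Hypothesis fK : cancel f g.
Hypothesis gK : cancel g f.
Hypothesis side_f : forall x, side (f x) = ~~ side x.
Hypothesis f2_neq : forall x, f (f x) != x.
Hypothesis f4_neq : forall x, f (f (f (f x))) != x.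
Hypothesis side_large : forall b, 4 < #|[set x | side x == b]|.
Hypothesis eE : forall x y, e x y = [&& side x != side y, f x != y & g x != y].

Lemma side_g x : side (g x) = ~~ side x.
Proof. by rewrite -{2}(gK x) side_f negbK. Qed.

Lemma eq_fg x y : (f x == y) = (g y == x).
Proof. by apply/eqP/eqP => <-. Qed.

Lemma e_sym : symmetric e.
Proof.
by move=> x y; rewrite !eE eq_sym -eq_fg eq_fg [X in _ && X]andbC.
Qed.

Lemma exists_side_notin b (s : seq T) :
  size s < 5 -> exists2 z, side z = b & z \notin s.
Proof.
move=> s5; have /card_gt0P[z] : 0 < #|[set x | side x == b] :\: [set x in s]|.
  rewrite cardsD subn_gt0 (leq_ltn_trans _ (side_large b)) //.
  rewrite (leq_trans (subset_leq_card (subsetIr _ _))) //.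
  by rewrite cardsE (leq_trans (card_size s)).
by rewrite !inE => /andP[zs /eqP zb]; exists z.
Qed.

(** Each of [x] and [y] is non-adjacent to only two vertices of the opposite side, and that side has
    at least five. *)
Lemma common_neighbour x y : side x = side y -> exists2 z, e x z & e z y.
Proof.
move=> xy; have [//|z zx] := @exists_side_notin (~~ side x) [:: f x; g x; f y; g y].
rewrite !inE !negb_or => /and4P[h1 h2 h3 h4]; exists z; first rewrite eE.
  by rewrite zx ![_ == z]eq_sym h1 h2; case: (side x).
by rewrite e_sym eE zx -xy ![_ == z]eq_sym h3 h4; case: (side x).
Qed.

Lemma side_path x (p : seq T) :
  path e x p -> side (last x p) = odd (size p) (+) side x.
Proof.
elim: p x => //= y p IH x /andP[exy /IH->].
by move: exy; rewrite eE; case: (side x); case: (side y); case: (odd _).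
Qed.

Lemma side_has_path x y n :
  has_path_of_length e x y n -> side y = odd n (+) side x.
Proof.
by case/existsP=> p /and3P[/side_path sp _ /eqP <-]; rewrite sp size_tuple.
Qed.

Lemma has_path0 x y : has_path_of_length e x y 0 = (x == y).
Proof.
apply/existsP/idP => [[p]|xy]; first by rewrite (tuple0 p) => /and3P[].
by exists [tuple].
Qed.

Lemma has_path1 x y : has_path_of_length e x y 1 = e x y.
Proof.
apply/existsP/idP => [[[[|z []] //= _]]|exy].
  by case/and3P=> /andP[exz _] _ /eqP <-.
exists [tuple y] => /=; rewrite exy eqxx !inE !andbT /=.
by apply: contraTneq exy => ->; rewrite eE eqxx.
Qed.

Lemma has_path2 x y : x != y -> side x = side y -> has_path_of_length e x y 2.
Proof.
move=> xy sxy; have [z exz ezy] := common_neighbour sxy.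
apply/existsP; exists [tuple z; y] => /=; rewrite exz ezy eqxx !inE !andbT /=.
rewrite negb_or xy andbT; apply/andP; split.
  by apply: contraTneq exz => ->; rewrite eE eqxx.
by apply: contraTneq ezy => ->; rewrite eE eqxx.
Qed.

Lemma has_path3 x y : side x != side y -> ~~ e x y -> has_path_of_length e x y 3.
Proof.
move=> sxy Nexy.
(* Used with [y] twice, this merely yields a neighbour [z] of [y]; the path is then [x], [u], [z],
   [y] with [u] adjacent to both [x] and [z]. *)
have [z eyz _] := common_neighbour (erefl (side y)).
have sxz : side x = side z.
  by move: eyz sxy; rewrite eE; case: (side x); case: (side y); case: (side z).
have [u exu euz] := common_neighbour sxz.
have irr v w : e v w -> v != w by apply: contraTneq => ->; rewrite eE eqxx.
have xz : x != z by apply: contraNneq Nexy => ->; rewrite e_sym.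
have xy : x != y by apply: contraNneq sxy => ->.
have uy : u != y by apply: contraNneq Nexy => <-.
apply/existsP; exists [tuple u; z; y].
rewrite /= exu euz (e_sym z) eyz eqxx !inE !negb_or xz xy uy.
by rewrite (irr _ _ exu) (irr _ _ euz) eq_sym (irr _ _ eyz).
Qed.

Lemma card_gt4 : 4 < #|T|.
Proof. exact: leq_trans (side_large true) (max_card _). Qed.

Lemma dist_cases x y :
  dist e x y = if x == y then 0 else if side x == side y then 2
               else if (f x == y) || (g x == y) then 3 else 1.
Proof.
have T4 := card_gt4.
case: eqP => [->|/eqP xy]; first by apply/eqP; rewrite dist_eq0.
case: eqP => [sxy|/eqP sxy].
  apply: dist_eq; [lia | exact: has_path2 | case=> [|[|//]] _].
    by rewrite has_path0.
  by rewrite has_path1 eE sxy eqxx.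
have := eE x y; rewrite sxy -negb_or /=; case: ifP => _ exy.
  apply: dist_eq; [lia | by rewrite has_path3 ?exy | case=> [|[|[|//]]] _].
  - by rewrite has_path0.
  - by rewrite has_path1 exy.
  - by apply: contra sxy => /side_has_path ->.
apply: dist_eq; [lia | by rewrite has_path1 exy | case=> [|//] _].
by rewrite has_path0.
Qed.

(** By parity, any single vertex of [W] distinguishes vertices on opposite sides. *)
Lemma odd_dist x y : odd (dist e x y) = side x (+) side y.
Proof.
rewrite dist_cases; case: eqP => [->|_]; first by rewrite addbb.
by case: (side x); case: (side y) => //=; case: ifP.
Qed.

Lemma connected_bipartite_minus_cycle : connected e.
Proof.
apply/forallP => x; apply/forallP => y.
have [->|xy] := eqVneq x y; first exact: connect0.
have [sxy|sxy] := eqVneq (side x) (side y).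
  exact: has_path_connect (has_path2 xy sxy).
have [exy|Nexy] := boolP (e x y); first exact: connect1.
exact: has_path_connect (has_path3 sxy Nexy).
Qed.

(** * Resolving sets as 0-1 words around the cycle *)

Definition zero_centre (W : {set T}) (x : T) : bool :=
  [&& x \notin W, f x \notin W & g x \notin W].

(** If [x] were the centre of 00100, its cycle neighbours [f x] and [g x] would both be at distance
    3 from [x], and from every other vertex of [W] at distance 1 or 2 according to its side. *)
Lemma resolving_isolated (W : {set T}) x :
  resolving e (enum W) -> x \in W ->
  [|| f x \in W, g x \in W, f (f x) \in W | g (g x) \in W].
Proof.
move=> rW xW; apply/negPn/negP; rewrite !negb_or => /and4P[fx gx ffx ggx].
have fg : f x != g x by rewrite eq_sym -eq_fg f2_neq.
move: rW => /forallP/(_ (f x))/forallP/(_ (g x))/implyP/(_ fg)/eqP; apply.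
apply/metric_repr_eq => w wW; rewrite !dist_cases fK gK side_f side_g.
have NW v : v \notin W -> (v == w) = false by apply: contraNF => /eqP->.
by rewrite (NW _ fx) (NW _ gx) (NW _ ffx) (NW _ ggx) orbF.
Qed.

(** From the centre of a 000 all distances to [W] are 1 or 2, so they depend on its side alone. *)
Lemma resolving_zero_centre (W : {set T}) x y :
  resolving e (enum W) -> zero_centre W x -> zero_centre W y ->
  side x = side y -> x = y.
Proof.
move=> rW /and3P[x0 x1 x2] /and3P[y0 y1 y2] sxy; apply/eqP/negPn/negP => xy.
move: rW => /forallP/(_ x)/forallP/(_ y)/implyP/(_ xy)/eqP; apply.
apply/metric_repr_eq => w wW; rewrite !dist_cases sxy.
have NW v : v \notin W -> (v == w) = false by apply: contraNF => /eqP->.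
by rewrite !NW.
Qed.

Lemma resolvingI (W : {set T}) :
  W != set0 ->
  (forall x, x \in W ->
    [|| f x \in W, g x \in W, f (f x) \in W | g (g x) \in W]) ->
  (forall x y, zero_centre W x -> zero_centre W y -> side x = side y -> x = y) ->
  resolving e (enum W).
Proof.
move=> /set0Pn[w0 w0W] iso cen.
apply/forallP => x; apply/forallP => y; apply/implyP => xy.
apply/eqP => /metric_repr_eq E.
have sxy : side x = side y.
  move: (congr1 odd (E w0 w0W)); rewrite !odd_dist.
  by case: (side x); case: (side y); case: (side w0).
have xW : x \notin W.
  apply/negP => xW; move: (E x xW); rewrite !dist_cases eqxx eq_sym (negbTE xy).
  by do ?case: ifP.
have yW : y \notin W.
  apply/negP => yW; move: (E y yW); rewrite !dist_cases eqxx (negbTE xy).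
  by do ?case: ifP.
(* Distance 3 against 1 reveals cycle adjacency, so [x] and [y] have the same cycle neighbours in
   [W]. *)
have nbr w : w \in W -> (f x == w) || (g x == w) = (f y == w) || (g y == w).
  move=> wW; move: (E w wW); rewrite !dist_cases sxy.
  have NW v : v \notin W -> (v == w) = false by apply: contraNF => /eqP->.
  rewrite (NW _ xW) (NW _ yW).
  case: (eqVneq (side y) (side w)) => [syw _|_]; last first.
    by do 2!case: (_ || _).
  have N z : side z = side w -> ((f z == w) = false) * ((g z == w) = false).
    move=> zw; split; apply: contra_eqF zw => /eqP <-;
    by rewrite ?side_f ?side_g; case: (side z).
  by rewrite !N ?sxy.
(* A shared neighbour [f u = g v] puts [v] two steps after [u]. Since 00100 is excluded, [g u] or
   [f v] is in [W], hence is shared too; then [f v = g u], and four steps of [f] return to [u]. *)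
have mid u v : u \notin W -> v \notin W ->
  (forall w, w \in W -> (f u == w) || (g u == w) = (f v == w) || (g v == w)) ->
  u != v -> f u \in W -> f u = g v -> False.
  move=> uW vW uvnbr uv fuW fugv.
  have f2u : f (f u) = v by rewrite fugv gK.
  have fvgu : f v == g u -> False.
    by rewrite eq_sym -eq_fg -f2u (negbTE (f4_neq u)).
  move: (iso _ fuW); rewrite f2u fK (negbTE uW) (negbTE vW) /=.
  case/orP => [/[dup] + /uvnbr|/[dup] + /uvnbr].
    rewrite eqxx (can_eq fK) (negbTE uv) /= => _; rewrite eq_sym => /fvgu //.
  rewrite eqxx orbT (can_eq gK) [v == u]eq_sym (negbTE uv) orbF => _ /esym.
  exact: fvgu.
have fN : f x \notin W.
  apply/negP => fxW; have := nbr _ fxW.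
  rewrite eqxx (can_eq fK) [y == x]eq_sym (negbTE xy) /= => /esym/eqP/esym.
  exact: mid.
have gN : g x \notin W.
  apply/negP => gxW; have := nbr _ gxW.
  (* Now the shared neighbour is [g x = f y], so [mid] applies with [x] and [y] exchanged. *)
  rewrite eqxx orbT (can_eq gK) [y == x]eq_sym (negbTE xy) orbF => /esym/eqP fy.
  have yxnbr w : w \in W -> (f y == w) || (g y == w) = (f x == w) || (g x == w).
    by move/nbr.
  by apply: (mid y x yW xW yxnbr _ _ fy); rewrite ?fy 1?eq_sym.
have NW v w : v \notin W -> w \in W -> (v == w) = false.
  by move=> vW wW; apply: contraNF vW => /eqP->.
case/eqP: xy; apply: cen sxy; first by rewrite /zero_centre xW fN gN.
apply/and3P; split=> //; apply/negP => vW; have := nbr _ vW;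
by rewrite eqxx ?orbT (NW _ _ fN vW) (NW _ _ gN vW).
Qed.

(** The discharging bound: [b] marks the ones, [z] the zeros, and the summand in [give] is what a
    one sends to its two sides. *)
Lemma resolving_card (W : {set T}) :
  resolving e (enum W) -> 2 * #|T| <= 5 * #|W| + 4.
Proof.
move=> rW; pose b x : nat := x \in W; pose z x : nat := x \notin W.
have bz x : b x + z x = 1 by rewrite /b /z; case: (x \in W).
(* [side] is injective on the centres of 000, and [bool] has two elements. *)
have cen2 : \sum_x (zero_centre W x : nat) <= 2.
  rewrite -big_mkcond sum1dep_card -card_bool.
  rewrite -(@card_in_imset _ _ side) ?max_card // => x y.
  by rewrite !inE; apply: resolving_zero_centre.
(* A one would send 4 only if all four surrounding entries were zeros. *)
have give : \sum_x b x * (z (f x) * (1 + z (f (f x))) +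
                          z (g x) * (1 + z (g (g x)))) <= \sum_x 3 * b x.
  apply: leq_sum => x _; have := @resolving_isolated W x rW.
  rewrite /b /z; case: (x \in W) => // /(_ isT).
  by do 4!case: (_ \in W).
(* Shifting one half of the sum by [g] and the other by [f] regroups the charges by the zero that
   receives them; a centre of 000 receives nothing and is compensated by 2. *)
have get : \sum_x 2 * z x =
    \sum_x b x * (z (f x) * (1 + z (f (f x))) + z (g x) * (1 + z (g (g x))))
    + \sum_x 2 * zero_centre W x.
  under [X in X + _]eq_bigr do rewrite mulnDr.
  rewrite [X in X + _]big_split /= [X in X + _ + _](reindex_inj (can_inj gK)).
  rewrite [X in _ + X + _](reindex_inj (can_inj fK)) -!big_split.
  apply: eq_bigr => x _ /=; rewrite fK gK /zero_centre /b /z.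
  by do 3!case: (_ \in W).
have bzT : \sum_x b x + \sum_x z x = #|T|.
  by rewrite -big_split -sum1_card; apply: eq_bigr => x _; exact: bz.
have bW : \sum_x b x = #|W|.
  by rewrite -sum1_card [RHS]big_mkcond; apply: eq_bigr => x _; rewrite /b; case: ifP.
move: give get bzT cen2; rewrite -!big_distrr /= bW.
set S := \sum_x b x * _; set C := \sum_x zero_centre W x; set Z := \sum_x z x.
by move: S C Z => S C Z; lia.
Qed.

End BipartiteMinusCycle.

(** * The periodic word 10100 on cyclic positions *)

Definition block_pattern (n i : nat) : bool :=
  (i %% 5 == 2) || (i %% 5 == 0) && (i + 5 <= n).

(** The first term counts the positions congruent to 2 modulo 5; the second counts the multiples of
    5, capped by the number of complete blocks. *)
Lemma count_block_pattern (n k : nat) :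
  count (block_pattern n) (iota 0 k) =
  (k + 2) %/ 5 + minn ((k + 4) %/ 5) (n %/ 5).
Proof.
elim: k => [|k IH]; first by rewrite min0n.
rewrite -addn1 iotaD count_cat IH /= /block_pattern; lia.
Qed.

Definition succ_mod (n i : nat) : nat := if i.+1 == n then 0 else i.+1.
Definition pred_mod (n i : nat) : nat := if i == 0 then n.-1 else i.-1.

Lemma block_pattern0 (n : nat) : 4 < n -> block_pattern n 0.
Proof. by rewrite /block_pattern => ->. Qed.

Lemma block_pattern_isolated (n i : nat) :
  9 < n -> i < n -> block_pattern n i ->
  [|| block_pattern n (succ_mod n i), block_pattern n (pred_mod n i),
      block_pattern n (succ_mod n (succ_mod n i))
    | block_pattern n (pred_mod n (pred_mod n i))].
Proof.
move=> n10 ltin.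
have p0 : block_pattern n 0 by apply: block_pattern0; lia.
have [i0|i2] := eqVneq (i %% 5) 0.
  rewrite {1}/block_pattern i0 /= => i5.
  have -> : succ_mod n (succ_mod n i) = i.+2 by rewrite /succ_mod !ifF //; lia.
  by rewrite [block_pattern n i.+2](_ : _ = true) ?orbT // /block_pattern; lia.
rewrite {1}/block_pattern (negbTE i2) orbF => /eqP {}i2.
(* The block containing [i] starts at [i - 2], so this asks whether it is complete and has kept its
   first 1. *)
have [in3|in3] := leqP (i + 3) n.
  have -> : pred_mod n (pred_mod n i) = i - 2 by rewrite /pred_mod !ifF; lia.
  by rewrite [block_pattern n (i - 2)](_ : _ = true) ?orbT // /block_pattern; lia.
(* In the incomplete block, the 1 at position 0 lies one or two places ahead across the
   wrap-around. *)
have [i1|i1] := eqVneq i.+1 n; first by rewrite {1}/succ_mod i1 eqxx p0.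
have -> : succ_mod n (succ_mod n i) = 0.
  by rewrite {2}/succ_mod (negbTE i1) /succ_mod ifT; lia.
by rewrite p0 !orbT.
Qed.

(** The erased 1 stood at [5 * (n %/ 5)]. A 000 can only be centred there or just before, and these
    two consecutive positions have opposite sides. *)
Lemma block_pattern_centre (n i : nat) :
  9 < n -> i < n -> ~~ block_pattern n i ->
  ~~ block_pattern n (succ_mod n i) -> ~~ block_pattern n (pred_mod n i) ->
  i = 5 * (n %/ 5) \/ i.+1 = 5 * (n %/ 5).
Proof.
move=> n10 ltin.
have p0 : block_pattern n 0 by apply: block_pattern0; lia.
case: i ltin => [|i] ltin; first by rewrite p0.
rewrite /succ_mod; case: eqP => [_|i1]; first by rewrite p0.
rewrite /pred_mod /block_pattern /=; lia.
Qed.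

(** * The Hamiltonian cycle of the complete bipartite graph *)

Section HamiltonianCycle.
Variables (m : nat) (c : seq ('I_m + 'I_m)).
Hypothesis m5 : 4 < m.
Hypothesis hc : hamiltonian_cycle (@complete_bipartite m m) c.

Let side (x : 'I_m + 'I_m) : bool := if x is inl _ then true else false.
Let n := m + m.

Let c_uniq : uniq c. Proof. by case/and4P: hc. Qed.

Let mem_c x : x \in c. Proof. by case/and4P: hc => _ _ _ /forallP. Qed.

Let card_n : #|{: 'I_m + 'I_m}| = n. Proof. by rewrite card_sum card_ord. Qed.

Let size_c : size c = n.
Proof.
rewrite -card_n -(card_uniqP c_uniq); apply: eq_card => x.
by rewrite mem_c.
Qed.

Let index_c x : index x c < n. Proof. by rewrite -size_c index_mem. Qed.

Let side_next x : side (next c x) = ~~ side x.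
Proof.
have /and4P[_ cc _ _] := hc.
by move: (next_cycle cc (mem_c x)); case: x => x; case: (next c _).
Qed.

Let nextK : cancel (next c) (prev c). Proof. exact: prev_next. Qed.
Let prevK : cancel (prev c) (next c). Proof. exact: next_prev. Qed.

Let index_next x : index (next c x) c = succ_mod n (index x c).
Proof.
have xc := mem_c x; have ix := index_c x; move: c_uniq size_c.
rewrite next_nth xc /succ_mod; case: c xc ix => // y p _ ix up sp.
case: eqP => [ixn|ixn].
  (* [next] looks up the tail [p] with the head [y] as default; at the last position the default
     closes the cycle. *)
  by rewrite nth_default ?index_head // -ltnS ixn -sp.
rewrite -[nth y p _]/(nth y (y :: p) _.+1) index_uniq //.
by rewrite sp ltn_neqAle ix andbT; apply/eqP.
Qed.

Let index_prev x : index (prev c x) c = pred_mod n (index x c).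
Proof.
have := index_next (prev c x); rewrite prevK /succ_mod /pred_mod => ->.
by case: (_ =P n) => [<-|].
Qed.

Let side_card b : 4 < #|[set x | side x == b]|.
Proof.
have inj_inl : injective (@inl 'I_m 'I_m) by move=> ? ? [].
have inj_inr : injective (@inr 'I_m 'I_m) by move=> ? ? [].
apply: (leq_trans m5); rewrite -[m in m <= _]card_ord.
case: b; [rewrite -(card_imset _ inj_inl) | rewrite -(card_imset _ inj_inr)];
by apply/subset_leq_card/subsetP => _ /imsetP[i _ ->]; rewrite inE.
Qed.

(** The cycle has at least ten vertices, so two or four steps cannot close it. *)
Let iter_next_neq x :
  (next c (next c x) != x) /\ (next c (next c (next c (next c x))) != x).
Proof.
have S y : index (next c y) c = (index y c).+1 \/
           (index y c).+1 = n /\ index (next c y) c = 0.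
  by rewrite index_next /succ_mod; case: eqP; [right | left].
have n10 : 9 < n by rewrite /n; lia.
have := S x; have := S (next c x); have := S (next c (next c x)).
have := S (next c (next c (next c x))).
by split; apply/eqP => /(congr1 (index^~ c)); lia.
Qed.

Let eE x y : del_cycle (@complete_bipartite m m) c x y =
  [&& side x != side y, next c x != y & prev c x != y].
Proof.
rewrite /del_cycle /cycle_edge !mem_c /= negb_or.
rewrite (can2_eq nextK prevK y x) [y == _]eq_sym.
by case: x y => x [].
Qed.

Let next2_neq x := proj1 (iter_next_neq x).
Let next4_neq x := proj2 (iter_next_neq x).

Definition block_set : {set 'I_m + 'I_m} :=
  [set x | block_pattern n (index x c)].

Lemma card_block_set : #|block_set| = (4 * m) %/ 5.
Proof.
have -> : #|block_set| = count (block_pattern n) (map (index^~ c) c).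
  rewrite count_map -size_filter -(card_uniqP (filter_uniq _ c_uniq)).
  by apply: eq_card => x; rewrite mem_filter mem_c andbT inE.
have -> : map (index^~ c) c = iota 0 n.
  rewrite -size_c; apply: (@eq_from_nth _ 0) => [|i].
    by rewrite size_map size_iota.
  rewrite size_map => ic; case: c ic c_uniq => // y p ic up.
  by rewrite (nth_map y) // index_uniq // nth_iota.
(* At [k = n] the minimum is [n %/ 5], and [(2 * m + 2) %/ 5 + (2 * m) %/ 5] equals
   [(4 * m) %/ 5]. *)
by rewrite count_block_pattern /n; lia.
Qed.

Lemma resolving_block_set :
  resolving (del_cycle (@complete_bipartite m m) c) (enum block_set).
Proof.
have n10 : 9 < n by rewrite /n; lia.
apply: (resolvingI nextK prevK side_next next4_neq side_card eE).
- by rewrite -card_gt0 card_block_set; lia.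
- move=> x; rewrite !inE !(index_next, index_prev).
  exact: block_pattern_isolated.
move=> x y /and3P[x0 x1 x2] /and3P[y0 y1 y2] sxy.
move: x0 x1 x2 y0 y1 y2; rewrite !inE !(index_next, index_prev).
move=> x0 x1 x2 y0 y1 y2.
have idx_inj u v : index u c = index v c -> u = v.
  exact: (index_inj u (mem_c u) (mem_c v)).
have adj u v : (index u c).+1 = index v c -> side u != side v.
  move=> uv; have vE : next c u = v.
    by apply: idx_inj; rewrite index_next /succ_mod uv ltn_eqF.
  by rewrite -vE side_next; case: (side u).
have := block_pattern_centre n10 (index_c x) x0 x1 x2.
have := block_pattern_centre n10 (index_c y) y0 y1 y2.
case=> iy [] ix.
- by apply: idx_inj; rewrite ix iy.
- by have := adj x y; rewrite ix iy sxy eqxx => /(_ erefl).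
- by have := adj y x; rewrite ix iy sxy eqxx => /(_ erefl).
by apply: idx_inj; apply: succn_inj; rewrite ix iy.
Qed.

Lemma del_hamiltonian_connected :
  connected (del_cycle (@complete_bipartite m m) c).
Proof.
exact: (connected_bipartite_minus_cycle nextK prevK side_card eE).
Qed.

Lemma del_hamiltonian_metric_dim :
  metric_dim (del_cycle (@complete_bipartite m m) c) = (4 * m) %/ 5.
Proof.
apply: metric_dim_eq => [W rW|]; last first.
  by exists block_set; [exact: resolving_block_set | rewrite card_block_set].
(* This reads [4 * m <= 5 * #|W| + 4]; the least integer not below (4m - 4)/5 is the floor of
   4m/5. *)
have := resolving_card nextK prevK side_next next2_neq side_card eE rW.
by rewrite card_n /n; lia.
Qed.

End HamiltonianCycle.

Theorem theorem2 (m : nat) (c : seq ('I_m + 'I_m)) :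
  5 <= m ->
  hamiltonian_cycle (@complete_bipartite m m) c ->
  connected (del_cycle (@complete_bipartite m m) c) /\
  metric_dim (del_cycle (@complete_bipartite m m) c) = (4 * m) %/ 5.
Proof.
by move=> m5 hc; split;
  [exact: del_hamiltonian_connected | exact: del_hamiltonian_metric_dim].
Qed.
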